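(* A polynomial $u\in\mathbb{Z}[x]$ of degree at least $1$ is locally nilpotent at $1$ if and only if it is of one of the following forms: (1) $(x-1)p(x)$ with $p(x)\in\mathbb{Z}[x]\setminus\{0\}$ (these are nilpotent at $1$ of index $1$); (2) $-2x+4+p(x)(x-1)(x-2)$ with $p(x)\in\mathbb{Z}[x]$ (these are nilpotent at $1$ of index $2$); (3) $-2x^2+7x-3+p(x)(x-1)(x-2)(x-3)$ with $p(x)\in\mathbb{Z}[x]$ (these are nilpotent at $1$ of index $3$); (4) $x+1$ (which is locally nilpotent but not nilpotent at $1$).
   Context: For $u\in\mathbb{Z}[x]$ of degree at least $1$, define iterates $u^{(1)}=u$ and $u^{(n+1)}(x)=u(u^{(n)}(x))$. $u$ is locally nilpotent at $r\in\mathbb{Z}$ if for every prime $p$ there exists $m\ge1$ with $u^{(m)}(r)\equiv 0\pmod p$. $u$ is nilpotent at $r$ if $u^{(n)}(r)=0$ for some $n\ge 1$, and the nilpotency index is the least such $n$. *)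

(* Defs.v *)
From mathcomp Require Import all_boot all_order all_algebra.

Set Implicit Arguments.
Unset Strict Implicit.
Unset Printing Implicit Defensive.

Import Order.TTheory GRing.Theory Num.Theory.

Local Open Scope ring_scope.

(* [piter u n] is the n-th iterate u^(n); the value at n = 0 is 'X, and only
   n >= 1 is used below. *)
Definition piter (u : {poly int}) (n : nat) : {poly int} :=
  iter n (fun q => u \Po q) 'X.

Lemma piter1 (u : {poly int}) : piter u 1 = u.
Proof. exact: comp_polyXr. Qed.

Lemma piterS (u : {poly int}) (n : nat) : piter u n.+1 = u \Po piter u n.
Proof. by []. Qed.

Definition locally_nilpotent (u : {poly int}) (r : int) : Prop :=
  forall p : nat, prime p ->
    exists m : nat, (1 <= m)%N /\ ((piter u m).[r] = 0 %[mod p])%Z.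

Definition nilpotent (u : {poly int}) (r : int) : Prop :=
  exists n : nat, (1 <= n)%N /\ (piter u n).[r] = 0.

Definition nilpotent_of_index (u : {poly int}) (r : int) (n : nat) : Prop :=
  [/\ (1 <= n)%N, (piter u n).[r] = 0
    & forall m : nat, (1 <= m < n)%N -> (piter u m).[r] <> 0].

(* Main.v *)
Require Import Defs.
From mathcomp Require Import all_boot all_order all_algebra.
From mathcomp Require Import zify.

Set Implicit Arguments.
Unset Strict Implicit.
Unset Printing Implicit Defensive.

Import Order.TTheory GRing.Theory Num.Theory.

Local Open Scope ring_scope.

(** Suppose the orbit of 1 starts 1, 2, ..., n and put c = u(n). If a prime
    q > n divided c - j for some 1 <= j <= n, then modulo q the orbit would stay
    in {1, ..., n} and avoid 0; so every c - j is nonzero with all its prime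
    factors at most n. For n <= 3 this leaves c = n + 1 or c = 0. For n >= 4,
    u - X - 1 vanishes at 1, ..., n - 1, so c = n + 1 + k (n - 1)!. Writing
    2t = k (n - 1)!, we get c - n = 1 + 2t and c - (n - 1) = 2 (1 + t). If t were
    nonzero, then n would be a prime dividing 1 + 2t, because 1 + 2t is coprime
    to (n - 1)!; so n >= 5, 1 + t is also prime to all primes below n, and n
    divides 1 + t as well, contradicting the coprimality of 1 + t and 1 + 2t.
    Hence c = n + 1, and either the orbit reaches 0 in at most three steps or u
    agrees with X + 1 at all positive integers. *)

(** * Congruences between values of an integer polynomial *)

Lemma hornerB_factor (u : {poly int}) (y : int) :
  exists q : {poly int}, forall x, u.[x] - u.[y] = q.[x] * (x - y).
Proof.
have /factor_theorem[q Hq] : root (u - u.[y]%:P) y.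
  by rewrite rootE !hornerE subrr.
exists q => x.
by rewrite -[X in _ - X](hornerC _ x) -hornerN -hornerD Hq !hornerE.
Qed.

Lemma dvdz_hornerB (u : {poly int}) (d x y : int) :
  (d %| x - y)%Z -> (d %| u.[x] - u.[y])%Z.
Proof. by have [q ->] := hornerB_factor u y => ?; apply: dvdz_mull. Qed.

Lemma piterS_horner (u : {poly int}) (m : nat) (r : int) :
  (piter u m.+1).[r] = u.[(piter u m).[r]].
Proof. by rewrite piterS horner_comp. Qed.

Lemma locally_nilpotent_dvd (u : {poly int}) (r : int) (p : nat) :
  locally_nilpotent u r -> prime p ->
  exists2 m, (0 < m)%N & (p %| (piter u m).[r])%Z.
Proof.
move=> Hu /Hu[m [m0 Hm]]; exists m => //.
by apply/dvdz_mod0P; rewrite Hm mod0z.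
Qed.

Lemma nilpotent_of_index_nilpotent (u : {poly int}) (r : int) (n : nat) :
  nilpotent_of_index u r n -> nilpotent u r.
Proof. by case=> n0 Hn _; exists n. Qed.

Lemma nilpotent_locally (u : {poly int}) (r : int) :
  nilpotent u r -> locally_nilpotent u r.
Proof. by case=> n [n0 Hn] p _; exists n; rewrite Hn. Qed.

(** * Orbits starting 1, ..., n and their reduction modulo a prime *)

Definition successor_below (u : {poly int}) (n : nat) : Prop :=
  forall i : nat, (0 < i < n)%N -> u.[i%:Z] = i.+1%:Z.

Lemma orbit_mod_trapped (u : {poly int}) (n j q : nat) :
  successor_below u n -> (0 < j <= n)%N -> (q %| u.[n%:Z] - j%:Z)%Z ->
  forall m, exists2 i : nat, (0 < i <= n)%N & (q %| (piter u m).[1] - i%:Z)%Z.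
Proof.
move=> Hs Hj Hq; elim=> [|m [i Hi Hd]].
  by exists 1%N; [lia | rewrite /piter /= hornerX subrr dvdz0].
have {}Hd := dvdz_hornerB u Hd; rewrite piterS_horner.
case: (eqVneq i n) => [ein|nin].
  exists j => //; rewrite ein in Hd.
  by have := rpredD Hd Hq; rewrite addrA subrK.
exists i.+1; first lia.
by rewrite -Hs //; lia.
Qed.

Lemma prime_dvd_le (u : {poly int}) (n j q : nat) :
  locally_nilpotent u 1 -> successor_below u n -> (0 < j <= n)%N ->
  prime q -> (q %| u.[n%:Z] - j%:Z)%Z -> (q <= n)%N.
Proof.
move=> Hu Hs Hj Hp Hq; rewrite leqNgt; apply/negP => lt_nq.
have [m m0 Hm] := locally_nilpotent_dvd Hu Hp.
(* At the step [m] where the orbit is 0 modulo [q], the trapped residue [i] is itself divisible by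
   [q], although [0 < i <= n < q]. *)
have [i Hi Hd] := orbit_mod_trapped Hs Hj Hq m.
have : (q %| i%:Z)%Z by have := rpredB Hm Hd; rewrite opprB addrC subrK.
by rewrite dvdzE /= => /dvdn_leq; lia.
Qed.

(** If equality held, the difference would be 0, which every prime divides, including one above
    [n]. *)
Lemma horner_neq_orbit (u : {poly int}) (n j : nat) :
  locally_nilpotent u 1 -> successor_below u n -> (0 < j <= n)%N ->
  u.[n%:Z] <> j%:Z.
Proof.
move=> Hu Hs Hj E; have := prime_above n => -[q lt_nq Hp].
have := prime_dvd_le Hu Hs Hj Hp; rewrite E subrr dvdz0 => /(_ isT).
by lia.
Qed.

Lemma prime_dvdz_exists (z : int) :
  z <> 1 -> z <> -1 -> exists2 q : nat, prime q & (q %| z)%Z.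
Proof.
move=> z1 zN1; case: (eqVneq z 0) => [->|z0]; first by exists 2%N.
exists (pdiv `|z|); last by rewrite dvdzE /= pdiv_dvd.
by rewrite pdiv_prime //; lia.
Qed.

Lemma prime_dvdz_1D (p : nat) (x : int) :
  prime p -> (p %| x)%Z -> ~ (p %| 1 + x)%Z.
Proof.
move=> Hp Hx Hx1; have : (p %| 1)%Z by have := rpredB Hx1 Hx; rewrite addrK.
by rewrite dvdz1 /= => /eqP p1; move: Hp; rewrite p1.
Qed.

(** * Possible values of u at the end of the initial segment *)

Lemma successor_belowS (u : {poly int}) (n : nat) :
  successor_below u n -> u.[n%:Z] = n.+1%:Z -> successor_below u n.+1.
Proof.
move=> Hs Hn i Hi; case: (eqVneq i n) => [->//|?]; apply: Hs; lia.
Qed.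

Lemma horner1_cases (u : {poly int}) :
  locally_nilpotent u 1 -> u.[1] = 0 \/ u.[1] = 2.
Proof.
move=> Hu; have Hs : successor_below u 1 by case=> [|[]].
have [E|n1] := eqVneq (u.[1] - 1) 1; first by right; lia.
have [E|n2] := eqVneq (u.[1] - 1) (-1); first by left; lia.
have [q Hp Hq] := prime_dvdz_exists (elimN eqP n1) (elimN eqP n2).
have := prime_dvd_le Hu Hs (j := 1) isT Hp Hq.
by have := prime_gt1 Hp; lia.
Qed.

Lemma horner2_cases (u : {poly int}) :
  locally_nilpotent u 1 -> successor_below u 2 -> u.[2] = 0 \/ u.[2] = 3.
Proof.
move=> Hu Hs.
have N1 := horner_neq_orbit Hu Hs (j := 1) isT.
have N2 := horner_neq_orbit Hu Hs (j := 2) isT.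
have L1 q := @prime_dvd_le u 2 1 q Hu Hs isT.
have L2 q := @prime_dvd_le u 2 2 q Hu Hs isT.
move: N1 N2 L1 L2; rewrite -[2%:Z]/(2 : int); set c := u.[_] => N1 N2 L1 L2.
have odd_unit (z : int) : (z %% 2)%Z = 1 ->
    (forall q : nat, prime q -> (q %| z)%Z -> (q <= 2)%N) -> z = 1 \/ z = -1.
  move=> Hz Hle.
  have [E|n1] := eqVneq z 1; first by left.
  have [E|n2] := eqVneq z (-1); first by right.
  have [q Hp Hq] := prime_dvdz_exists (elimN eqP n1) (elimN eqP n2).
  have q2 : q = 2%N by have := prime_gt1 Hp; have := Hle q Hp Hq; lia.
  by move: Hq; rewrite q2; lia.
(* One of two consecutive integers is odd; having no prime factor but 2, it is 1 or -1. The values 1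
   and 2 of [c] are already excluded. *)
have [Hc|Hc] : (c - 1) %% 2 = 1 :> int \/ (c - 2) %% 2 = 1 :> int by lia.
  by have := odd_unit _ Hc L1; lia.
by have := odd_unit _ Hc L2; lia.
Qed.

Lemma successor_below_factor (u : {poly int}) (n : nat) :
  successor_below u n.+1 ->
  exists q : {poly int}, u = 'X + 1 + q * \prod_(i < n) ('X - (i.+1%:Z)%:P).
Proof.
elim: n => [|n IHn] Hs.
  by exists (u - ('X + 1)); rewrite big_ord0 mulr1 addrC subrK.
have [|q Hq] := IHn; first by move=> i Hi; apply: Hs; lia.
(* The product does not vanish at [n.+1], so the cofactor [q] must. *)
have /factor_theorem[q' Hq'] : root q n.+1%:Z.
  have : q.[n.+1%:Z] * \prod_(i < n) ('X - (i.+1%:Z)%:P).[n.+1%:Z] = 0.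
    have := Hs n.+1; rewrite {1}Hq !hornerE horner_prod ltnSn => /(_ isT) Hn.
    by apply: (addrI (n.+1%:Z + 1)); rewrite Hn addr0; lia.
  move/eqP; rewrite mulf_eq0 => /orP[//|/prodf_eq0[i _]].
  by rewrite !hornerE; have := ltn_ord i; lia.
by exists q'; rewrite big_ord_recr /= Hq Hq' -mulrA [_ * \prod_(_ < _) _]mulrC.
Qed.

Lemma horner_successor_below (u : {poly int}) (n : nat) :
  successor_below u n.+1 ->
  exists k : int, u.[n.+1%:Z] = n.+2%:Z + k * (n`!)%:Z.
Proof.
move/successor_below_factor => [q ->]; exists q.[n.+1%:Z].
rewrite !hornerE horner_prod; congr (_ + _ * _); first lia.
rewrite fact_prod big_add1 big_mkord (big_morph Posz PoszM (erefl _)).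
(* At [n.+1] the factors are n, ..., 1, the reverse of the order in the factorial. *)
rewrite [RHS](reindex_inj rev_ord_inj) /=; apply: eq_bigr => i _.
by rewrite !hornerE; have := ltn_ord i; lia.
Qed.

(** Here c = 4 + 2k is even, so c - 1 and c - 3 are odd and 3 is their only possible prime factor.
    Differing by 2, they are not both multiples of 3, so one of them is 1 or -1; c = 2 is
    excluded. *)
Lemma horner3_cases (u : {poly int}) :
  locally_nilpotent u 1 -> successor_below u 3 -> u.[3] = 0 \/ u.[3] = 4.
Proof.
move=> Hu Hs.
have N2 := horner_neq_orbit Hu Hs (j := 2) isT.
have L1 q := @prime_dvd_le u 3 1 q Hu Hs isT.
have L3 q := @prime_dvd_le u 3 3 q Hu Hs isT.
have [k] := horner_successor_below Hs.
move: N2 L1 L3; rewrite -[3%:Z]/(3 : int); set c := u.[_] => N2 L1 L3.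
rewrite -[2`!]/2%N => Hc.
have dvd3 (z : int) : (z %% 2)%Z = 1 -> z <> 1 -> z <> -1 ->
    (forall q : nat, prime q -> (q %| z)%Z -> (q <= 3)%N) -> (3 %| z)%Z.
  move=> Hz z1 zN1 Hle; have [q Hp Hq] := prime_dvdz_exists z1 zN1.
  have [q2|q3] : q = 2%N \/ q = 3%N.
    by have := prime_gt1 Hp; have := Hle q Hp Hq; lia.
  - by move: Hq; rewrite q2; lia.
  - by move: Hq; rewrite q3.
have D1 := dvd3 (c - 1) _ _ _ L1.
have D3 := dvd3 (c - 3) _ _ _ L3.
lia.
Qed.

Lemma fact_dvd_fact (m n : nat) : (m <= n)%N -> (m`! %| n`!)%N.
Proof. by move=> le_mn; rewrite -(bin_fact le_mn) dvdn_mull // dvdn_mulr. Qed.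

Lemma horner_ge4 (u : {poly int}) (n : nat) : (3 <= n)%N ->
  locally_nilpotent u 1 -> successor_below u n.+1 -> u.[n.+1%:Z] = n.+2%:Z.
Proof.
move=> n3 Hu Hs.
have Ln q := @prime_dvd_le u n.+1 n.+1 q Hu Hs.
have Lm q := @prime_dvd_le u n.+1 n q Hu Hs.
have [k Hk] := horner_successor_below Hs.
have /dvdnP[f Hf] : (6 %| n`!)%N by exact: (@fact_dvd_fact 3).
have fact_dvd q : prime q -> (q <= n)%N -> (q %| n`!)%N.
  by move=> Hp Hq; rewrite dvdn_fact // prime_gt0.
(* Half of [k * n!]. Being a multiple of 3, a nonzero [t] is neither -1 nor -2, so [1 + 2 * t] and
   [1 + t] are not units and have prime divisors. *)
pose t := k * (3 * f)%:Z.
have Ht : k * (n`!)%:Z = 2 * t by rewrite /t Hf; lia.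
rewrite Hk Ht; suff -> : t = 0 by lia.
have t3 : (3 %| t)%Z by rewrite /t; lia.
have [//|t0] := eqVneq t 0.
have [||q Hp Hq] := @prime_dvdz_exists (1 + 2 * t); [lia|lia|].
have [||r Hr Hrt] := @prime_dvdz_exists (1 + t); [lia|lia|].
have q_le : (q <= n.+1)%N.
  apply: Ln => //; first lia.
  by rewrite Hk Ht; have <- : 1 + 2 * t = n.+2%:Z + 2 * t - n.+1%:Z by lia.
have r_le : (r <= n.+1)%N.
  apply: Lm => //; first lia.
  rewrite Hk Ht; have -> : n.+2%:Z + 2 * t - n%:Z = 2 * (1 + t) by lia.
  exact: dvdz_mull.
have dvd_2t p : prime p -> (p <= n)%N -> (p %| 2 * t)%Z.
  by move=> Pp le_pn; rewrite -Ht dvdz_mull // dvdzE fact_dvd.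
have [le_qn|lt_nq] := leqP q n.
  by case: (prime_dvdz_1D Hp (dvd_2t q Hp le_qn)).
have {lt_nq q_le} q_eq : q = n.+1 by lia.
(* For [n = 3] the prime [q] would be 4. *)
have n4 : (4 <= n)%N.
  rewrite ltn_neqAle n3 andbT; apply/eqP => n_eq.
  by move: Hp; rewrite q_eq -n_eq.
have [le_rn|lt_nr] := leqP r n; last first.
  have r_eq : r = q by lia.
  have Hr2 : (r %| 1 + (1 + 2 * t))%Z.
    have -> : 1 + (1 + 2 * t) = 2 * (1 + t) by lia.
    exact: dvdz_mull.
  by case: (prime_dvdz_1D Hr _ Hr2); rewrite r_eq.
case: (prime_dvdz_1D Hr _ Hrt).
(* It remains to show that [r] divides [t]. For [r = 2] this needs 24 to divide [n!], which makes
   [f] even; an odd [r] divides [2 * t] and is coprime to 2. *)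
have [r2|r2] := eqVneq r 2%N.
  have /dvdnP[g Hg] : (24 %| n`!)%N by exact: (@fact_dvd_fact 4).
  have f_eq : f = (2 * (2 * g))%N by lia.
  by rewrite r2 /t f_eq; lia.
have := dvd_2t r Hr le_rn; rewrite Gauss_dvdzr // coprimezE /=.
by rewrite prime_coprime // dvdn_prime2.
Qed.

(** * From the values of u to the four forms *)

Lemma successor_all (u : {poly int}) :
  (forall n : nat, (0 < n)%N -> u.[n%:Z] = n.+1%:Z) -> u = 'X + 1.
Proof.
move=> Hu; apply/eqP; rewrite -subr_eq0; set v := u - _.
(* As many distinct roots as [size v], one more than the degree allows unless [v = 0]. *)
pose rs := [seq i.+1%:Z | i <- iota 0 (size v)].
have [//|v0] := eqVneq v 0.
have := max_poly_roots v0 (rs := rs); rewrite size_map size_iota ltnn; apply.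
  apply/allP => _ /mapP[i _ ->].
  by rewrite rootE /v !hornerE Hu //; apply/eqP; lia.
by rewrite map_inj_uniq ?iota_uniq // => i j [].
Qed.

Lemma horner_nat_factor (v : {poly int}) (n : nat) :
  v.[n%:R] = 0 -> exists p : {poly int}, v = p * ('X - n%:R).
Proof.
by move/eqP/factor_theorem => [p ->]; exists p; rewrite polyC_natr.
Qed.

Lemma horner_nat_cofactor (p : {poly int}) (m n : nat) :
  (p * ('X - n%:R)).[m%:R] = 0 -> m != n -> p.[m%:R] = 0.
Proof.
rewrite -polyC_natr hornerM hornerXsubC => /eqP.
by rewrite mulf_eq0 subr_eq0 eqr_nat => /orP[/eqP //|->].
Qed.

Lemma locally_nilpotent_forms (u : {poly int}) : (1 < size u)%N ->
  locally_nilpotent u 1 ->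
  [\/ exists p : {poly int}, p <> 0 /\ u = ('X - 1) * p,
      exists p : {poly int}, u = - 2 * 'X + 4 + p * ('X - 1) * ('X - 2),
      exists p : {poly int},
        u = - 2 * 'X^2 + 7 * 'X - 3 + p * ('X - 1) * ('X - 2) * ('X - 3)
    | u = 'X + 1].
Proof.
move=> su Hu; have Hs1 : successor_below u 1 by case=> [|[]].
have [E1|E1] := horner1_cases Hu.
  have [p Hp] := horner_nat_factor (n := 1) E1.
  constructor 1; exists p; split; last by rewrite Hp mulrC.
  by move=> p0; move: su; rewrite Hp p0 mul0r size_poly0.
have Hs2 := successor_belowS Hs1 E1.
have [E2|E2] := horner2_cases Hu Hs2.
  (* The subtracted polynomial interpolates 1 -> 2 -> 0. *)
  pose v := u - (- 2 * 'X + 4).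
  have v1 : v.[1] = 0 by rewrite /v !hornerE E1.
  have v2 : v.[2] = 0 by rewrite /v !hornerE E2.
  have [p Hp] := horner_nat_factor (n := 2) v2.
  move: v1; rewrite Hp => /(horner_nat_cofactor (m := 1))/(_ isT) p1.
  have [q Hq] := horner_nat_factor (n := 1) p1.
  by constructor 2; exists q; rewrite -Hq -Hp /v addrC subrK.
have Hs3 := successor_belowS Hs2 E2.
have [E3|E3] := horner3_cases Hu Hs3.
  (* The subtracted polynomial interpolates 1 -> 2 -> 3 -> 0. *)
  pose v := u - (- 2 * 'X^2 + 7 * 'X - 3).
  have v1 : v.[1] = 0 by rewrite /v !hornerE E1.
  have v2 : v.[2] = 0 by rewrite /v !hornerE E2.
  have v3 : v.[3] = 0 by rewrite /v !hornerE E3.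
  have [p Hp] := horner_nat_factor (n := 3) v3.
  move: v1; rewrite Hp => /(horner_nat_cofactor (m := 1))/(_ isT) p1.
  move: v2; rewrite Hp => /(horner_nat_cofactor (m := 2))/(_ isT) p2.
  have [q Hq] := horner_nat_factor (n := 2) p2.
  move: p1; rewrite Hq => /(horner_nat_cofactor (m := 1))/(_ isT) q1.
  have [r Hr] := horner_nat_factor (n := 1) q1.
  by constructor 3; exists r; rewrite -Hr -Hq -Hp /v addrC subrK.
constructor 4; apply: successor_all => n n0.
have Hs : successor_below u (n + 4).
  elim: {n0} n => [|n IHn]; first exact: successor_belowS Hs3 E3.
  rewrite addSn; apply: successor_belowS => //; rewrite addnS.
  by apply: horner_ge4 => //; [lia | rewrite -addnS].
by apply: Hs; lia.
Qed.

(** * The four forms are locally nilpotent *)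

Lemma form1_index (p : {poly int}) : nilpotent_of_index (('X - 1) * p) 1 1.
Proof. by split=> [//||[|m]] //; rewrite piter1 !hornerE. Qed.

Lemma form2_index (p : {poly int}) :
  nilpotent_of_index (- 2 * 'X + 4 + p * ('X - 1) * ('X - 2)) 1 2.
Proof.
set u := (X in nilpotent_of_index X).
have u1 : u.[1] = 2 by rewrite /u !hornerE /=; lia.
have u2 : u.[2] = 0 by rewrite /u !hornerE /=; lia.
split=> //; first by rewrite piterS_horner piter1 u1 u2.
by case=> [|[|m]] // _; rewrite piter1 u1.
Qed.

Lemma form3_index (p : {poly int}) :
  nilpotent_of_index
    (- 2 * 'X^2 + 7 * 'X - 3 + p * ('X - 1) * ('X - 2) * ('X - 3)) 1 3.
Proof.
set u := (X in nilpotent_of_index X).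
have u1 : u.[1] = 2 by rewrite /u !hornerE /=; lia.
have u2 : u.[2] = 3 by rewrite /u !hornerE /=; lia.
have u3 : u.[3] = 0 by rewrite /u !hornerE /=; lia.
have it2 : (piter u 2).[1] = 3 by rewrite piterS_horner piter1 u1 u2.
split=> //; first by rewrite piterS_horner it2 u3.
by case=> [|[|[|m]]] // _; rewrite ?it2 ?piter1 ?u1.
Qed.

Lemma piter_succ (m : nat) : (piter ('X + 1) m).[1] = m.+1%:Z.
Proof.
elim: m => [|m IHm]; first by rewrite /piter /= hornerX.
by rewrite piterS_horner IHm !hornerE /=; lia.
Qed.

Lemma succ_locally_nilpotent : locally_nilpotent ('X + 1) 1.
Proof.
(* The orbit starts at 1, so it reaches [p] after [p.-1] steps, and [p.-1] is positive. *)
move=> p Hp; have p1 := prime_gt1 Hp; exists p.-1; split; first lia.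
by rewrite piter_succ prednK ?modzz ?mod0z // /=; lia.
Qed.

Lemma succ_not_nilpotent : ~ nilpotent ('X + 1) 1.
Proof. by case=> n [_]; rewrite piter_succ. Qed.

Theorem theorem1 :
  [/\ forall u : {poly int}, (1 < size u)%N ->
        (locally_nilpotent u 1 <->
         [\/ exists p : {poly int}, p <> 0 /\ u = ('X - 1) * p,
             exists p : {poly int},
               u = - 2 * 'X + 4 + p * ('X - 1) * ('X - 2),
             exists p : {poly int},
               u = - 2 * 'X^2 + 7 * 'X - 3
                   + p * ('X - 1) * ('X - 2) * ('X - 3)
           | u = 'X + 1]),
      forall p : {poly int}, p <> 0 ->
        nilpotent_of_index (('X - 1) * p) 1 1,
      forall p : {poly int},
        nilpotent_of_index (- 2 * 'X + 4 + p * ('X - 1) * ('X - 2)) 1 2,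
      forall p : {poly int},
        nilpotent_of_index
          (- 2 * 'X^2 + 7 * 'X - 3 + p * ('X - 1) * ('X - 2) * ('X - 3)) 1 3
    & locally_nilpotent ('X + 1) 1 /\ ~ nilpotent ('X + 1) 1].
Proof.
have loc u n (Hn : nilpotent_of_index u 1 n) : locally_nilpotent u 1.
  exact/nilpotent_locally/nilpotent_of_index_nilpotent/Hn.
split=> [u su|p _|p|p|].
- split; first exact: locally_nilpotent_forms.
  case=> [[p [_ ->]]|[p ->]|[p ->]|->].
  + exact/loc/form1_index.
  + exact/loc/form2_index.
  + exact/loc/form3_index.
  + exact: succ_locally_nilpotent.
- exact: form1_index.
- exact: form2_index.
- exact: form3_index.
- by split; [exact: succ_locally_nilpotent | exact: succ_not_nilpotent].
Qed.
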